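(* Let $T=\{\mathbf a,\mathbf b,c\mathbf e_1,\dots,c\mathbf e_n\}$ be as in the context, suppose that $\gcd(c,a_1,\dots,a_n,b_1,\dots,b_n)=1$, and suppose that neither of $\operatorname{supp}\mathbf a$ and $\operatorname{supp}\mathbf b$ is contained in the other. Let $c'$ be the greatest common divisor of $c$ and all the integers $a_ib_j-a_jb_i$ with $1\le i<j\le n$, and set $$g(T)=\frac{c'}{\gcd(c',a_1,\dots,a_n)\,\gcd(c',b_1,\dots,b_n)}.$$ Then $T$ is completely $p$-glued (a) for exactly one prime $p$, if and only if $g(T)$ is a positive power of $p$; (b) for every prime $p$, if and only if $g(T)=1$; (c) for no prime $p$, if and only if $g(T)$ has two distinct prime divisors. Case (b) occurs if and only if $T$ is a complete intersection.
   Context: $\mathbb N=\{0,1,2,\dots\}$. Let $n\ge1$ and $c\ge1$ be integers, let $\mathbf e_1,\dots,\mathbf e_n$ be the canonical basis of $\mathbb Z^n$, and let $\mathbf a=(a_1,\dots,a_n),\mathbf b=(b_1,\dots,b_n)\in\mathbb N^n$ be such that for every $i$ we have $a_i\ne0$ or $b_i\ne0$. Let $T=\{\mathbf a,\mathbf b,c\mathbf e_1,\dots,c\mathbf e_n\}$, where the $n+2$ listed vectors are distinct. For $\mathbf v\in\mathbb Z^n$, $\operatorname{supp}\mathbf v=\{i: v_i\neq0\}$. For a subset $S\subset\mathbb Z^n$, $\mathbb N S$ and $\mathbb Z S$ denote the sets of all $\mathbb N$-linear, respectively $\mathbb Z$-linear, combinations of elements of $S$. Let $S=S_1\cup S_2$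 with $S_1,S_2$ nonempty and $S_1\cap S_2=\emptyset$ (where $S$ is a finite subset of $\mathbb N^n$). - $S$ is a gluing of $S_1$ and $S_2$ if there is a nonzero $\mathbf w\in\mathbb N^n$ with $\mathbb Z S_1\cap\mathbb Z S_2=\mathbb Z\mathbf w$ and $\mathbf w\in\mathbb N S_1\cap\mathbb N S_2$. - For a prime $p$, $S$ is a $p$-gluing of $S_1$ and $S_2$ if there are an integer $k\ge0$ and a nonzero $\mathbf w\in\mathbb Z^n$ with $\mathbb Z S_1\cap\mathbb Z S_2=\mathbb Z\mathbf w$ and $p^k\mathbf w\in\mathbb N S_1\cap\mathbb N S_2$. - (Recursive definition) $S$ is a complete intersection if it is the gluing of two such subsets $S_1,S_2$, each of which is a complete intersection or generates a free abelian semigroup. - (Recursive definition) $S$ is completely $p$-glued if it is the $p$-gluing of two such subsets $S_1,S_2$, each of which is completely $p$-glued or generates a free abelian semigroup. *)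

(* Defs.v *)
From HB Require Import structures.
From mathcomp Require Import all_boot all_order all_algebra.
From mathcomp Require Import finmap.

Set Implicit Arguments.
Unset Strict Implicit.
Unset Printing Implicit Defensive.

Import Order.TTheory GRing.Theory Num.Theory.
Local Open Scope fset_scope.
Local Open Scope ring_scope.

Definition Nspan n (S : {fset 'rV[int]_n}) (v : 'rV[int]_n) : Prop :=
  exists k : 'rV[int]_n -> nat, v = \sum_(s <- S) s *+ k s.

Definition Zspan n (S : {fset 'rV[int]_n}) (v : 'rV[int]_n) : Prop :=
  exists k : 'rV[int]_n -> int, v = \sum_(s <- S) s *~ k s.

(* [Nspan S] is a free abelian semigroup (with 0). The basis [B] need not be
   [S] itself: {e, 2e} generates the free semigroup with basis {e}. A finite
   [B] loses nothing, since a basis of a finitely generated free abelian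
   semigroup is finite. *)
Definition generates_free n (S : {fset 'rV[int]_n}) : Prop :=
  exists B : {fset 'rV[int]_n},
    (forall v, Nspan S v <-> Nspan B v) /\
    (forall k l : 'rV[int]_n -> nat,
       \sum_(s <- B) s *+ k s = \sum_(s <- B) s *+ l s -> {in B, k =1 l}).

Definition splits n (S S1 S2 : {fset 'rV[int]_n}) : Prop :=
  [/\ S = S1 `|` S2, S1 `&` S2 = fset0, S1 <> fset0 & S2 <> fset0].

Definition gluing n (S S1 S2 : {fset 'rV[int]_n}) : Prop :=
  splits S S1 S2 /\
  exists w : 'rV[int]_n,
    [/\ w <> 0, forall i, 0 <= w 0 i,
        forall v, Zspan S1 v /\ Zspan S2 v <-> exists m : int, v = w *~ m
      & Nspan S1 w /\ Nspan S2 w].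

Definition pgluing (p : nat) n (S S1 S2 : {fset 'rV[int]_n}) : Prop :=
  splits S S1 S2 /\
  exists (k : nat) (w : 'rV[int]_n),
    [/\ w <> 0,
        forall v, Zspan S1 v /\ Zspan S2 v <-> exists m : int, v = w *~ m
      & Nspan S1 (w *+ (p ^ k)%N) /\ Nspan S2 (w *+ (p ^ k)%N)].

(* Both recursions go through proper subsets, so the least solution is the only
   one. A free [S] is not accepted as such: at least one gluing is required. *)
Inductive complete_intersection n (S : {fset 'rV[int]_n}) : Prop :=
  CompleteIntersection (S1 S2 : {fset 'rV[int]_n}) of
    gluing S S1 S2 &
    complete_intersection S1 \/ generates_free S1 &
    complete_intersection S2 \/ generates_free S2.

Inductive completely_pglued (p : nat) n (S : {fset 'rV[int]_n}) : Prop :=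
  CompletelyPGlued (S1 S2 : {fset 'rV[int]_n}) of
    pgluing p S S1 S2 &
    completely_pglued p S1 \/ generates_free S1 &
    completely_pglued p S2 \/ generates_free S2.

Definition vecZ n (a : 'rV[nat]_n) : 'rV[int]_n := map_mx Posz a.

Definition supp n (a : 'rV[nat]_n) : {set 'I_n} := [set i | a 0 i != 0%N].

Definition Tseq n (c : nat) (a b : 'rV[nat]_n) : seq 'rV[int]_n :=
  [:: vecZ a, vecZ b & [seq delta_mx 0 i *+ c | i <- enum 'I_n]].

Definition Tset n (c : nat) (a b : 'rV[nat]_n) : {fset 'rV[int]_n} :=
  [fset v in Tseq c a b].

Definition gcdv n (a : 'rV[nat]_n) : nat := \big[gcdn/0%N]_(i < n) a 0 i.

Definition cprime n (c : nat) (a b : 'rV[nat]_n) : nat :=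
  gcdn c (\big[gcdn/0%N]_(i < n) \big[gcdn/0%N]_(j < n | (i < j)%N)
            `|((a 0 i)%:Z * (b 0 j)%:Z - (a 0 j)%:Z * (b 0 i)%:Z)%R|%N).

(* The natural-number quotient is exact under the standing gcd hypothesis:
   see [gT_exact]. *)
Definition gT n (c : nat) (a b : 'rV[nat]_n) : nat :=
  (cprime c a b
     %/ (gcdn (cprime c a b) (gcdv a) * gcdn (cprime c a b) (gcdv b)))%N.

Lemma gT_exact n (c : nat) (a b : 'rV[nat]_n) :
  gcdn c (gcdn (gcdv a) (gcdv b)) = 1%N ->
  (gT c a b * (gcdn (cprime c a b) (gcdv a) * gcdn (cprime c a b) (gcdv b)))%N
  = cprime c a b.
Proof.
move=> h; apply: divnK; rewrite Gauss_dvd ?dvdn_gcdl //.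
have hc : (cprime c a b %| c)%N by exact: dvdn_gcdl.
rewrite /coprime -dvdn1 -h !dvdn_gcd; apply/and3P; split.
- by apply: dvdn_trans hc; apply: dvdn_trans (dvdn_gcdl _ _) (dvdn_gcdl _ _).
- by apply: dvdn_trans (dvdn_gcdl _ _) (dvdn_gcdr _ _).
- by apply: dvdn_trans (dvdn_gcdr _ _) (dvdn_gcdr _ _).
Qed.

(* Main.v *)
Require Import Defs.
From HB Require Import structures.
From mathcomp Require Import all_boot all_order all_algebra.
From mathcomp Require Import finmap.
From mathcomp Require Import zify ring.

Set Implicit Arguments.
Unset Strict Implicit.
Unset Printing Implicit Defensive.

Import Order.TTheory GRing.Theory Num.Theory.
Local Open Scope fset_scope.
Local Open Scope ring_scope.

(** Write G for the group (Z/c)^n, and let a and b also denote their classes in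
    it. The proof rests on reading g(T) as the order of the intersection of the
    cyclic subgroups <a> and <b> of G: <a> has order c / gcd(c, a), and since
    gcd(c, a, b) = 1 the subgroup <a> + <b> has order c * (c / c'). Equivalently,
    the multiples x a that lie in Zb + cZ^n are those with m | x, the multiples
    that lie in cZ^n are those with m g(T) | x, and m g(T) gcd(c, a) = c
    ([gT_order]). The description is symmetric in a and b.

    Only the outermost splitting T = S1 + S2 has to be understood, because the
    incomparability of the supports leaves few of them. Let w generate the
    intersection of ZS1 and ZS2.

    If a and b lie on the same side, then for every i on which the other side has
    c e_i, cutting c a and c b down to these coordinates gives two elements of Zw,
    which therefore vanish or have the same support. Positivity of the
    relation expressing a multiple of w then forces a and b to have disjoint
    supports ([disjoint_supp_of_same_side]), and in that case g(T) = 1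
    ([gT_eq1_of_disjoint]).

    If a and b are separated, the same cutting argument shows that all the
    c e_i lie on one side ([cvec_same_side_of_separated]), say S1 = {a}. Then
    w = m a up to sign. A nonnegative combination of b and the c e_i equal to
    p^k w cannot involve b, whose support is not contained in that of a; hence
    p^k m a is in cZ^n, that is, g(T) divides p^k ([gT_dvd_of_separated]).

    Conversely T is glued from {a} and the rest along w = m a, and g(T) w is in
    cN^n ([scaled_gluing_split_off]); the rest is always a complete
    intersection, glued from {b} and the free set of the c e_i
    ([complete_intersection_add_cset]). So T is completely p-glued if and only
    if g(T) is a power of p, and a complete intersection if and only if
    g(T) = 1; the four assertions follow by looking at the prime divisors of
    g(T). *)

(** * Subsemigroups and subgroups spanned by a finite set *)

Lemma mulmxzE m n (M : 'M[int]_(m, n)) (z : int) i j : (M *~ z) i j = M i j * z.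
Proof. by rewrite -scaler_int mxE intz mulrC. Qed.

Lemma Nspan_ind n (S : {fset 'rV[int]_n}) (P : 'rV[int]_n -> Prop) :
    P 0 -> (forall u v, P u -> P v -> P (u + v)) ->
    (forall s, s \in S -> P s) ->
  forall v, Nspan S v -> P v.
Proof.
move=> P0 PD PS v [k ->]; rewrite big_seq; apply: big_ind => // s /PS Ps.
by elim: (k s) => [|m IH]; rewrite ?mulr0n // mulrS; apply: PD.
Qed.

Lemma Zspan_ind n (S : {fset 'rV[int]_n}) (P : 'rV[int]_n -> Prop) :
    P 0 -> (forall u v, P u -> P v -> P (u + v)) -> (forall u, P u -> P (- u)) ->
    (forall s, s \in S -> P s) ->
  forall v, Zspan S v -> P v.
Proof.
move=> P0 PD PN PS v [k ->]; rewrite big_seq; apply: big_ind => // s /PS Ps.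
have PM m : P (s *+ m).
  by elim: m => [|m IH]; rewrite ?mulr0n // mulrS; apply: PD.
by case: (k s) => m; [apply: PM | apply/PN/PM].
Qed.

Lemma Nspan0 n (S : {fset 'rV[int]_n}) : Nspan S 0.
Proof. by exists (fun=> 0%N); rewrite big1 // => s _; rewrite mulr0n. Qed.

Lemma NspanD n (S : {fset 'rV[int]_n}) u v :
  Nspan S u -> Nspan S v -> Nspan S (u + v).
Proof.
move=> [k ->] [l ->]; exists (fun s => k s + l s)%N.
by rewrite -big_split; apply: eq_bigr => s _; rewrite mulrnDr.
Qed.

Lemma Nspan_mem n (S : {fset 'rV[int]_n}) s m : s \in S -> Nspan S (s *+ m).
Proof.
move=> sS; exists (fun t => if t == s then m else 0%N).
rewrite (bigD1_seq s) //= eqxx big1 ?addr0 // => t /negPf ->; exact: mulr0n.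
Qed.

Lemma Zspan0 n (S : {fset 'rV[int]_n}) : Zspan S 0.
Proof. by exists (fun=> 0); rewrite big1 // => s _; rewrite mulr0z. Qed.

Lemma ZspanD n (S : {fset 'rV[int]_n}) u v :
  Zspan S u -> Zspan S v -> Zspan S (u + v).
Proof.
move=> [k ->] [l ->]; exists (fun s => k s + l s).
by rewrite -big_split; apply: eq_bigr => s _; rewrite mulrzDr.
Qed.

Lemma Zspan_mem n (S : {fset 'rV[int]_n}) s z :
  (z != 0 -> s \in S) -> Zspan S (s *~ z).
Proof.
have [-> _|_ /(_ isT) sS] := eqVneq z 0; first by rewrite mulr0z; apply: Zspan0.
exists (fun t => if t == s then z else 0).
rewrite (bigD1_seq s) //= eqxx big1 ?addr0 // => t /negPf ->; exact: mulr0z.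
Qed.

Lemma Zspan_fset1 n (s v : 'rV[int]_n) :
  Zspan [fset s] v <-> exists z : int, v = s *~ z.
Proof.
split=> [[k ->]|[z ->]]; first by exists (k s); rewrite big_seq_fset1.
by apply: Zspan_mem => _; rewrite inE.
Qed.

Lemma generates_free1 n (s : 'rV[int]_n) : s != 0 -> generates_free [fset s].
Proof.
move=> s0; exists [fset s]; split=> // k l; rewrite !big_seq_fset1 => eq_kl t.
rewrite inE => /eqP ->; have [i si0] : exists i, s 0 i != 0.
  apply/existsP; apply: contraNT s0 => /existsPn s0; apply/eqP/rowP => i.
  by rewrite mxE; apply/eqP; move: (s0 i); rewrite negbK.
have := congr1 (fun v : 'rV__ => v 0 i) eq_kl.
by rewrite !mulmxnE -[_ *+ k s]mulr_natr -[_ *+ l s]mulr_natr !natz => /(mulfI si0)[].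
Qed.

(** * Coordinates with respect to T *)

Definition cvec n c i : 'rV[int]_n := delta_mx 0 i *+ c.

Lemma cvecE n c i j : @cvec n c i 0 j = c%:Z * (i == j)%:R.
Proof.
by rewrite /cvec mulmxnE mxE eqxx /= eq_sym -[_ *+ c]mulr_natr (natz c) mulrC.
Qed.

Lemma in_Tset n c (a b : 'rV[nat]_n) v :
  (v \in Tset c a b) = [|| v == vecZ a, v == vecZ b | v \in codom (cvec c)].
Proof. by rewrite !inE. Qed.

(** Since a, b and the c e_i are linearly dependent, coordinates are a relation
    and not a function. The first three clauses confine them to [S], so that one
    notion serves every subset [S] of T. *)
Definition coords n c (a b : 'rV[nat]_n) (S : {fset 'rV[int]_n})
    (x y : int) (z : 'I_n -> int) (v : 'rV[int]_n) : Prop :=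
  [/\ x != 0 -> vecZ a \in S, y != 0 -> vecZ b \in S,
      forall i, z i != 0 -> cvec c i \in S
    & forall i, v 0 i = x * (a 0 i)%:Z + y * (b 0 i)%:Z + z i * c%:Z].

Lemma coords0 n c (a b : 'rV[nat]_n) S : coords c a b S 0 0 (fun=> 0) 0.
Proof. by split; rewrite ?eqxx // => i; rewrite mxE; ring. Qed.

Lemma coordsD n c (a b : 'rV[nat]_n) S x y z u x' y' z' u' :
    coords c a b S x y z u -> coords c a b S x' y' z' u' ->
  coords c a b S (x + x') (y + y') (fun i => z i + z' i) (u + u').
Proof.
have nz (r s : int) (P : Prop) : (r != 0 -> P) -> (s != 0 -> P) -> r + s != 0 -> P.
  have [->|r0] := eqVneq r 0; first by rewrite add0r.
  by move=> H _ _; apply: H.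
move=> [xS yS zS uE] [xS' yS' zS' uE']; split.
- exact: nz.
- exact: nz.
- by move=> i; apply: nz (zS i) (zS' i).
by move=> i; rewrite mxE uE uE'; ring.
Qed.

Lemma coordsN n c (a b : 'rV[nat]_n) S x y z u :
  coords c a b S x y z u -> coords c a b S (- x) (- y) (fun i => - z i) (- u).
Proof.
move=> [xS yS zS uE]; split; rewrite ?oppr_eq0 //.
- by move=> i; rewrite oppr_eq0; apply: zS.
by move=> i; rewrite mxE uE; ring.
Qed.

Lemma coords_mem n c (a b : 'rV[nat]_n) (S : {fset 'rV[int]_n}) s :
    S `<=` Tset c a b -> s \in S ->
  exists x y z, [/\ 0 <= x, 0 <= y, forall i, 0 <= z i & coords c a b S x y z s].
Proof.
move=> /fsubsetP sT sS; have := sT s sS; rewrite in_Tset => /or3P[/eqP sE|/eqP sE|].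
- exists 1, 0, (fun=> 0); split=> //; split; rewrite ?eqxx -?sE // => i.
  by rewrite sE mxE; ring.
- exists 0, 1, (fun=> 0); split=> //; split; rewrite ?eqxx -?sE // => i.
  by rewrite sE mxE; ring.
case/codomP=> j sE; exists 0, 0, (fun i => (j == i)%:R).
split=> //; split; rewrite ?eqxx // => i;
  last by rewrite sE cvecE; ring.
by have [<-|_] := eqVneq j i; rewrite ?eqxx // -sE.
Qed.

(** The coordinates of an element of [Nspan S] can be chosen nonnegative: this
    is where all the positivity arguments about gluings come from. *)
Lemma Nspan_coords n c (a b : 'rV[nat]_n) (S : {fset 'rV[int]_n}) v :
    S `<=` Tset c a b -> Nspan S v ->
  exists x y z, [/\ 0 <= x, 0 <= y, forall i, 0 <= z i & coords c a b S x y z v].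
Proof.
move=> sT; elim/Nspan_ind: v / => [|u v|s sS]; last exact: coords_mem.
  by exists 0, 0, (fun=> 0); split=> //; apply: coords0.
move=> [x [y [z [x0 y0 z0 xyz]]]] [x' [y' [z' [x0' y0' z0' xyz']]]].
exists (x + x'), (y + y'), (fun i => z i + z' i).
by split; rewrite ?addr_ge0 //; [move=> i; rewrite addr_ge0 | apply: coordsD].
Qed.

Lemma Zspan_coords n c (a b : 'rV[nat]_n) (S : {fset 'rV[int]_n}) v :
  S `<=` Tset c a b -> Zspan S v <-> exists x y z, coords c a b S x y z v.
Proof.
move=> sT; split=> [|[x [y [z [xS yS zS vE]]]]].
  elim/Zspan_ind: v / => [|u v|u|s sS].
  - by exists 0, 0, (fun=> 0); apply: coords0.
  - move=> [x [y [z xyz]]] [x' [y' [z' xyz']]].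
    by exists (x + x'), (y + y'), (fun i => z i + z' i); apply: coordsD.
  - move=> [x [y [z xyz]]].
    by exists (- x), (- y), (fun i => - z i); apply: coordsN.
  by have [x [y [z [_ _ _ xyz]]]] := coords_mem sT sS; exists x, y, z.
have ->: v = vecZ a *~ x + vecZ b *~ y + \sum_i cvec c i *~ z i.
  apply/rowP => i; rewrite vE !mxE summxE !mulmxzE !mxE (bigD1 i) //=.
  rewrite big1 => [|j /negPf ji]; rewrite mulmxzE cvecE ?ji ?eqxx /=; ring.
apply: ZspanD; first by apply: ZspanD; apply: Zspan_mem.
apply: big_ind => [||i _]; [exact: Zspan0 | exact: ZspanD | exact: Zspan_mem (zS i)].
Qed.

Lemma Nspan_cvec n c (S : {fset 'rV[int]_n}) (v : 'rV[int]_n) :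
    (forall i, cvec c i \in S) ->
    (forall i, 0 <= v 0 i) -> (forall i, (c %| v 0%R i)%Z) ->
  Nspan S v.
Proof.
move=> cS v0 vc.
have ->: v = \sum_i cvec c i *+ `|(v 0%R i %/ c)%Z|%N.
  apply/rowP => i; rewrite summxE (bigD1 i) //= big1 => [|j /negPf ji];
    rewrite mulmxnE cvecE ?ji ?eqxx; last by rewrite mulr0 mul0rn.
  rewrite mulr1 addr0 -mulr_natr natz gez0_abs ?divz_ge0_abs //.
    by rewrite mulrC divzK.
  by case: c {cS vc} => [|c]; rewrite ?divz0 // divz_ge0.
by apply: big_ind => [||i _]; [exact: Nspan0 | exact: NspanD | exact: Nspan_mem].
Qed.

Definition cset n c : {fset 'rV[int]_n} := [fset v in codom (cvec c)].

Lemma generates_free_cset n c : (0 < c)%N -> generates_free (cset n c).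
Proof.
move=> c0; exists (cset n c); split=> // k l eq_kl s sS.
move: (sS); rewrite inE => /codomP[i sE].
have sumE (h : 'rV[int]_n -> nat) :
    (\sum_(t <- cset n c) t *+ h t) 0 i = c%:Z * (h s)%:Z.
  rewrite summxE (bigD1_seq s) ?fset_uniq //= mulmxnE sE cvecE eqxx.
  rewrite big_seq_cond big1 => [|t]; first by rewrite mulr1 addr0 -mulr_natr natz.
  rewrite inE => /andP[/codomP[j ->]]; rewrite mulmxnE cvecE.
  by have [->|_] := eqVneq j i; rewrite ?eqxx // mulr0 mul0rn.
have := congr1 (fun v : 'rV__ => v 0 i) eq_kl; rewrite !sumE.
have cZ : c%:Z != 0 by rewrite -lt0n.
by move/(mulfI cZ) => [].
Qed.
(** * The integer g(T) as a quotient of two orders *)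

Lemma dvdz_mul_gcd (d z : int) (m k : nat) :
  (d %| z * m)%Z -> (d %| z * k)%Z -> (d %| z * (gcdn m k)%:Z)%Z.
Proof.
move=> dm dk; have [u [v uv]] := Bezoutz m k.
have ->: (gcdn m k)%:Z = u * m + v * k by rewrite uv.
rewrite mulrDr; apply: rpredD; rewrite mulrCA; exact: dvdz_mull.
Qed.

Lemma dvdz_mul_biggcd (I : finType) (P : pred I) (F : I -> nat) (d z : int) :
    (forall i, P i -> (d %| z * F i)%Z) ->
  (d %| z * (\big[gcdn/0%N]_(i | P i) F i)%:Z)%Z.
Proof.
move=> dF; apply: (big_ind (fun m : nat => (d %| z * m)%Z)) => //.
  by rewrite mulr0 dvdz0.
exact: dvdz_mul_gcd.
Qed.

Lemma dvdz_mul_gcdv n (a : 'rV[nat]_n) (d : nat) (z : int) :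
  (forall i, (d %| z * a 0%R i)%Z) <-> (d %| z * gcdv a)%Z.
Proof.
split=> [da|da i]; first exact: dvdz_mul_biggcd.
apply: dvdz_trans da _; apply: dvdz_mul => //.
by apply: (dvdn_trans (biggcdn_inf i _ (dvdnn _))).
Qed.

(** Here [m] is the order of [a] modulo [c]. *)
Lemma dvdz_mul_gcdvE n (a : 'rV[nat]_n) (c m : nat) (z : int) :
    (0 < c)%N -> (m * gcdn c (gcdv a))%N = c ->
  (forall i, (c %| z * a 0%R i)%Z) <-> (m %| z)%Z.
Proof.
move=> c0 mc.
have g0 : (gcdn c (gcdv a))%:Z != 0 by rewrite -lt0n gcdn_gt0 c0.
rewrite dvdz_mul_gcdv -[(m %| z)%Z](dvdz_mul2r g0) -PoszM mc; split=> [cz|cz].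
  by apply: dvdz_mul_gcd => //; apply: dvdz_mull.
by apply: dvdz_trans cz _; apply: dvdz_mul => //; apply: dvdn_gcdr.
Qed.

Lemma Bezout_gcdv n (b : 'rV[nat]_n) :
  exists y : 'I_n -> int, (gcdv b)%:Z = \sum_i y i * (b 0%R i)%:Z.
Proof.
apply: (big_ind (fun d : nat =>
  exists y : 'I_n -> int, d%:Z = \sum_i y i * (b 0%R i)%:Z)).
- by exists (fun=> 0); rewrite big1 // => i _; rewrite mul0r.
- move=> d e [y dE] [y' eE]; have [u [v uv]] := Bezoutz d e.
  exists (fun i => u * y i + v * y' i).
  have ->: (gcdn d e)%:Z = u * d + v * e by rewrite uv.
  rewrite dE eE !mulr_sumr -big_split; apply: eq_bigr => i _ /=; ring.
move=> i _; exists (fun j => (j == i)%:R); rewrite (bigD1 i) //= eqxx mul1r.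
by rewrite big1 ?addr0 // => j /negPf ->; rewrite mul0r.
Qed.

Lemma dvdz_mul_cprime n c (a b : 'rV[nat]_n) (d : nat) (z : int) :
  (d %| z * cprime c a b)%Z <->
  (d %| z * c)%Z /\
  forall i j,
    (d %| z * ((a 0%R i)%:Z * (b 0%R j)%:Z - (a 0%R j)%:Z * (b 0%R i)%:Z))%Z.
Proof.
have dabs (x : int) : (d %| z * `|x|%N)%Z = (d %| z * x)%Z.
  by rewrite !dvdzE !abszM.
split=> [dz|[dc dm]].
  split=> [|i j]; first by apply: dvdz_trans dz _; apply: dvdz_mul => //; apply: dvdn_gcdl.
  wlog ij : i j / (i < j)%N => [H|].
    have [ij|ji|/val_inj->] := ltngtP i j; first exact: H.
      by rewrite -[(_ %| _)%Z]rpredN -mulrN opprB; apply: H.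
    by rewrite subrr mulr0 dvdz0.
  rewrite -dabs; apply: dvdz_trans dz _; apply: dvdz_mul => //.
  apply: dvdn_trans (dvdn_gcdr _ _) _; apply: (biggcdn_inf i) => //.
  exact: (biggcdn_inf j).
apply: dvdz_mul_gcd => //; apply: dvdz_mul_biggcd => i _.
by apply: dvdz_mul_biggcd => j _; rewrite dabs.
Qed.

Lemma cprimeC n c (a b : 'rV[nat]_n) : cprime c a b = cprime c b a.
Proof.
congr gcdn; apply: eq_bigr => i _; apply: eq_bigr => j _.
by rewrite -abszN opprB mulrC [X in _ - X]mulrC.
Qed.

Lemma gTC n c (a b : 'rV[nat]_n) : gT c a b = gT c b a.
Proof. by rewrite /gT cprimeC mulnC. Qed.

(** [gcdn c (gcdv a)] divides every minor a_i b_j - a_j b_i. *)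
Lemma gcd_cprimel n c (a b : 'rV[nat]_n) :
  gcdn (cprime c a b) (gcdv a) = gcdn c (gcdv a).
Proof.
apply/eqP; rewrite eqn_dvd; apply/andP; split; rewrite dvdn_gcd dvdn_gcdr andbT.
  by rewrite (dvdn_trans (dvdn_gcdl _ _)) ?dvdn_gcdl.
set d := gcdn c _; suff: (d %| 1%:Z * (cprime c a b)%:Z)%Z by rewrite mul1r dvdzE.
apply/dvdz_mul_cprime; split=> [|i j]; first by rewrite mul1r; apply: dvdn_gcdl.
have da k : (d %| (a 0%R k)%:Z)%Z.
  exact: dvdn_trans (dvdn_gcdr _ _) (biggcdn_inf k _ (dvdnn _)).
by rewrite mul1r rpredB //; apply: dvdz_mulr.
Qed.

Lemma gcd_cprimer n c (a b : 'rV[nat]_n) :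
  gcdn (cprime c a b) (gcdv b) = gcdn c (gcdv b).
Proof. by rewrite cprimeC gcd_cprimel. Qed.

(** If x a = y b mod c, then multiplying the congruences for i and j by b_j and
    b_i and subtracting shows that x times a minor is divisible by c gcd(c, b),
    and gcd(c, a, b) = 1 gives gcd(c, b) | x. In the other direction, write
    x = x1 gcd(c, b) and gcd(c, b) = u c + v (sum of y_j b_j); then the
    multiplier x1 v (sum of y_j a_j) of b works, because the minors
    allow a_j b_i to be replaced by a_i b_j. *)
Lemma mul_mod_multiple n c (a b : 'rV[nat]_n) (x : int) :
    gcdn c (gcdn (gcdv a) (gcdv b)) = 1%N -> (0 < c)%N ->
  (exists y : int, forall i, (c %| x * a 0%R i - y * b 0%R i)%Z) <->
  ((c * gcdn c (gcdv b))%N %| x * cprime c a b)%Z.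
Proof.
move=> cop c0; set e := gcdn c (gcdv b).
have e0 : e%:Z != 0 by rewrite -lt0n gcdn_gt0 c0.
have ec : (e%:Z %| c%:Z)%Z by apply: dvdn_gcdl.
have eb j : (e%:Z %| (b 0%R j)%:Z)%Z.
  exact: dvdn_trans (dvdn_gcdr _ _) (biggcdn_inf j _ (dvdnn _)).
split=> [[y xy]|].
  apply/dvdz_mul_cprime; split=> [|i j]; last first.
    have ->: x * ((a 0%R i)%:Z * (b 0%R j)%:Z - (a 0%R j)%:Z * (b 0%R i)%:Z) =
      (x * a 0%R i - y * b 0%R i) * (b 0%R j)%:Z - (x * a 0%R j - y * b 0%R j) * (b 0%R i)%:Z.
      ring.
    by apply: rpredB; apply: dvdz_mul (xy _) (eb _).
  rewrite PoszM [x * _]mulrC; apply: (dvdz_mul (dvdzz _)); rewrite -[x]mulr1 -[1]/(1%N%:Z) -cop.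
  apply: dvdz_mul_gcd; first exact: dvdz_mull.
  apply: dvdz_mul_gcd; apply: dvdz_mul_biggcd => i _; last exact: dvdz_mull.
  have /(dvdz_trans ec) := xy i; rewrite rpredBr //; exact: dvdz_mull.
move=> /dvdz_mul_cprime[].
rewrite PoszM [x * _]mulrC dvdz_mul2l -?lt0n // => /dvdzP[x1 ->] minors.
have [y bE] := Bezout_gcdv b; have [u [v uv]] := Bezoutz c (gcdv b).
have eE : e%:Z = u * c + v * \sum_j y j * (b 0%R j)%:Z by rewrite -bE uv.
exists (x1 * v * \sum_j y j * (a 0%R j)%:Z) => i.
have ->: x1 * e%:Z * (a 0%R i)%:Z - x1 * v * (\sum_j y j * (a 0%R j)%:Z) * (b 0%R i)%:Z =
  (x1 * u * a 0%R i) * c +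
  \sum_j v * y j * (x1 * ((a 0%R i)%:Z * (b 0%R j)%:Z - (a 0%R j)%:Z * (b 0%R i)%:Z)).
  rewrite eE.
  have ->: \sum_j v * y j *
      (x1 * ((a 0%R i)%:Z * (b 0%R j)%:Z - (a 0%R j)%:Z * (b 0%R i)%:Z))
    = x1 * v * a 0%R i * (\sum_j y j * (b 0%R j)%:Z)
      - x1 * v * b 0%R i * (\sum_j y j * (a 0%R j)%:Z).
    rewrite !mulr_sumr -sumrB; apply: eq_bigr => j _; ring.
  ring.
apply: rpredD; first exact: dvdz_mull.
apply: rpred_sum => j _; apply: dvdz_mull.
by have := minors i j; rewrite mulrAC dvdz_mul2r.
Qed.

(** The quantity [m] is the order of [a] modulo the subgroup generated by [b]
    and cZ^n, while [m * gT c a b] is the order of [a] modulo cZ^n. *)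
Lemma gT_order n c (a b : 'rV[nat]_n) :
    gcdn c (gcdn (gcdv a) (gcdv b)) = 1%N -> (0 < c)%N ->
  exists m : nat, [/\ (0 < m)%N, (m * gT c a b * gcdn c (gcdv a))%N = c
    & forall x : int,
       (exists y : int, forall i, (c %| x * a 0%R i - y * b 0%R i)%Z) <-> (m %| x)%Z].
Proof.
move=> cop c0; have := gT_exact cop; rewrite gcd_cprimel gcd_cprimer.
set ea := gcdn c (gcdv a); set eb := gcdn c _ => gE.
have c'0 : (0 < cprime c a b)%N by rewrite gcdn_gt0 c0.
have /dvdnP[r cE] : (cprime c a b %| c)%N by apply: dvdn_gcdl.
exists (r * eb)%N.
have mE : (r * eb * gT c a b * ea)%N = c.
  by rewrite [RHS]cE -gE; ring.
split=> // [|x]; first by move: c0; rewrite -{1}mE; case: (r * eb)%N.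
rewrite mul_mod_multiple // -/eb.
have ->: (c * eb)%N = (r * eb * cprime c a b)%N by rewrite [in LHS]cE; ring.
by rewrite PoszM dvdz_mul2r // -lt0n.
Qed.

(** When the supports are disjoint, a congruence x a = y b mod c splits into
    x a = 0 and y b = 0, so the two orders of [gT_order] agree. *)
Lemma gT_eq1_of_disjoint n c (a b : 'rV[nat]_n) :
    gcdn c (gcdn (gcdv a) (gcdv b)) = 1%N -> (0 < c)%N ->
    (forall i, a 0 i = 0%N \/ b 0 i = 0%N) ->
  gT c a b = 1%N.
Proof.
move=> cop c0 dis; have [m [m0 mE mP]] := gT_order cop c0.
have [y yP] := (mP m).2 (dvdzz _).
have /(dvdz_mul_gcdvE _ c0 mE) : forall i, (c %| m%:Z * a 0%R i)%Z.
  move=> i; have [->|b0] := dis i; first by rewrite mulr0.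
  by have := yP i; rewrite b0 mulr0 subr0.
by rewrite dvdzE /= -{2}[m]muln1 dvdn_pmul2l // dvdn1 => /eqP.
Qed.

(** * The possible gluings of T *)

Lemma TsetC n c (a b : 'rV[nat]_n) : Tset c a b = Tset c b a.
Proof. by apply/fsetP => v; rewrite !in_Tset orbCA. Qed.

Lemma pgluingC p n (S S1 S2 : {fset 'rV[int]_n}) :
  pgluing p S S1 S2 -> pgluing p S S2 S1.
Proof.
move=> [[SE S12 S1n S2n] [k [w [w0 wZ [W1 W2]]]]]; split.
  by split=> //; rewrite 1?fsetUC // fsetIC.
exists k, w; split=> // v; rewrite -wZ; split=> -[]; by split.
Qed.

Lemma splits_sub n (S S1 S2 : {fset 'rV[int]_n}) :
  splits S S1 S2 ->
  [/\ S1 `<=` S, S2 `<=` S, {in S, forall s, (s \in S1) || (s \in S2)}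
    & forall s, s \in S1 -> s \in S2 -> False].
Proof.
move=> [-> S12 _ _]; rewrite fsubsetUl fsubsetUr; split=> // s; rewrite ?inE //.
by move=> s1 s2; have := in_fset0 s; rewrite -S12 inE s1 s2.
Qed.

Lemma supp_witness n (a b : 'rV[nat]_n) :
  ~~ (supp a \subset supp b) -> exists i, a 0 i != 0%N /\ b 0 i = 0%N.
Proof. by case/subsetPn=> i; rewrite !inE negbK => ai /eqP bi; exists i. Qed.

Lemma cvec_sides p n c (a b : 'rV[nat]_n) S1 S2 i :
  pgluing p (Tset c a b) S1 S2 -> (cvec c i \in S1) || (cvec c i \in S2).
Proof.
by case=> /splits_sub[_ _ cov _] _; apply: cov; rewrite in_Tset codom_f !orbT.
Qed.

(** The vector c v with the coordinates i such that c e_i is not in [S] erased.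
    Erasing a coordinate of c v amounts to subtracting a multiple of c e_i. *)
Definition cut n c (S : {fset 'rV[int]_n}) (v : 'rV[nat]_n) : 'rV[int]_n :=
  \row_i if cvec c i \in S then (c * v 0%R i)%:Z else 0.

(** The cut is a combination of the c e_i in [S2] by construction; it is also c a
    minus a combination of the c e_i outside [S2], hence of elements of [S1]. *)
Lemma cut_common p n c (a b : 'rV[nat]_n) S1 S2 :
    pgluing p (Tset c a b) S1 S2 -> vecZ a \in S1 ->
  Zspan S1 (cut c S2 a) /\ Zspan S2 (cut c S2 a).
Proof.
move=> glT aS1; have [sub1 sub2 _ dis] := splits_sub glT.1; split.
  apply/(Zspan_coords _ sub1).
  exists c%:Z, 0, (fun i => if cvec c i \in S2 then 0 else - (a 0 i)%:Z).
  split=> // i; last by rewrite mxE; case: ifP => _; rewrite ?PoszM; ring.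
  have := cvec_sides i glT.
  by case: (cvec c i \in S2); rewrite ?eqxx // orbF => ->.
apply/(Zspan_coords _ sub2).
exists 0, 0, (fun i => if cvec c i \in S2 then (a 0 i)%:Z else 0).
split; rewrite ?eqxx // => i; first by case: ifP => //; rewrite eqxx.
by rewrite mxE; case: ifP => _; rewrite ?PoszM; ring.
Qed.

(** Two nonzero multiples of the same [w] have the same support, so every
    coordinate at which one cut is nonzero is one at which the other is. *)
Lemma cuts_meet p n c (a b : 'rV[nat]_n) S1 S2 (R R' : {fset 'rV[int]_n})
    (u v : 'rV[nat]_n) i j : (0 < c)%N ->
    pgluing p (Tset c a b) S1 S2 ->
    Zspan S1 (cut c R u) /\ Zspan S2 (cut c R u) ->
    Zspan S1 (cut c R' v) /\ Zspan S2 (cut c R' v) ->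
    cvec c i \in R -> cvec c j \in R' -> u 0 i != 0%N -> v 0 j != 0%N ->
  cvec c i \in R' /\ v 0 i != 0%N.
Proof.
move=> c0 [_ [k [w [_ wZ _]]]] /wZ[x xE] /wZ[y yE] iR jR' ui vj.
have coord (Q : {fset 'rV[int]_n}) t z h : cut c Q t = w *~ z ->
    (if cvec c h \in Q then (c * t 0%R h)%:Z else 0) = w 0 h * z.
  by move=> tE; rewrite -mulmxzE -tE mxE.
have nzc m : (m != 0%N) -> (c * m)%:Z != 0.
  by move=> m0; rewrite eqz_nat muln_eq0 negb_or m0 -lt0n c0.
have wi : w 0 i != 0.
  apply: contraNneq (nzc _ ui) => wi0.
  by have := coord _ _ _ i xE; rewrite iR wi0 mul0r => ->.
have y0 : y != 0.
  apply: contraNneq (nzc _ vj) => y0.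
  by have := coord _ _ _ j yE; rewrite jR' y0 mulr0 => ->.
have := mulf_neq0 wi y0; rewrite -(coord _ _ _ i yE).
case: ifP => // _; rewrite eqz_nat muln_eq0 negb_or => /andP[_ ->] //.
Qed.

(** The hypothesis on [a] says that [a] is supported where [S2] has its c e_i.
    If some b_i with i in that region were nonzero, the cuts of [a] and [b] would
    have the same support, contradicting an index at which [a] is nonzero and
    [b] is zero. *)
Lemma disjoint_supp_of_same_side p n c (a b : 'rV[nat]_n) S1 S2 :
    (0 < c)%N -> pgluing p (Tset c a b) S1 S2 ->
    vecZ a \in S1 -> vecZ b \in S1 -> ~~ (supp a \subset supp b) ->
    (forall j, cvec c j \notin S2 -> a 0 j = 0%N) ->
  forall i, a 0 i = 0%N \/ b 0 i = 0%N.
Proof.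
move=> c0 glT aS1 bS1 /supp_witness[j [aj bj]] a0 i.
have [iS2|/a0] := boolP (cvec c i \in S2); last by left.
have jS2 : cvec c j \in S2 by apply: contraNT aj => /a0 ->.
have glT' : pgluing p (Tset c b a) S1 S2 by rewrite TsetC.
have [|bi] := eqVneq (b 0 i) 0%N; [by right | left].
have [_] := cuts_meet c0 glT (cut_common glT aS1) (cut_common glT' bS1)
  jS2 iS2 aj bi.
by rewrite bj.
Qed.

Lemma glue_multiple p n c (a b : 'rV[nat]_n) (S1 S2 : {fset 'rV[int]_n}) :
    prime p -> pgluing p (Tset c a b) S1 S2 ->
  exists W : 'rV[int]_n, [/\ W != 0, Nspan S1 W & Nspan S2 W].
Proof.
move=> p_pr glT; have [_ [k [w [/eqP w0 _ [W1 W2]]]]] := glT.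
exists (w *+ p ^ k); split=> //; apply: contraNneq w0 => W0.
apply/eqP/rowP => i; have := congr1 (fun v : 'rV__ => v 0 i) W0.
rewrite mulmxnE !mxE => /eqP; rewrite mulrn_eq0 -leqn0 leqNgt expn_gt0 prime_gt0 //.
by move=> /eqP.
Qed.

(** If c e_j were in [S2], the common nonzero combination W would vanish at j, as
    nothing on the side of [a] reaches j. But b_j is nonzero, so the nonnegative
    combination on the side of [b] does not involve [b]: it vanishes wherever
    c e_i is in [S1], and W would be 0. *)
Lemma cvec_same_side_of_separated p n c (a b : 'rV[nat]_n) S1 S2 :
    prime p -> pgluing p (Tset c a b) S1 S2 ->
    (forall i : 'I_n, a 0 i <> 0%N \/ b 0 i <> 0%N) ->
    vecZ a \in S1 -> vecZ b \in S2 ->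
    (forall j, cvec c j \in S2 -> a 0 j = 0%N) ->
  forall i, cvec c i \in S1.
Proof.
move=> p_pr glT hab aS1 bS2 a0 j; apply/negPn/negP => jS1.
have [sub1 sub2 _ dis] := splits_sub glT.1.
have [W [/eqP W0]] := glue_multiple p_pr glT.
move=> /(Nspan_coords sub1)[x [y [z [x0 y0 z0 [_ yS zS WE]]]]].
move=> /(Nspan_coords sub2)[x' [y' [z' [x0' y0' z0' [xS' _ zS' WE']]]]].
have yE : y = 0 by apply/eqP/negPn/negP => /yS /dis; apply.
have xE' : x' = 0 by apply/eqP/negPn/negP => /xS'; apply: dis.
have W_S2 i : cvec c i \in S2 -> W 0 i = 0.
  move=> iS2; rewrite WE yE a0 //.
  have ->: z i = 0 by apply/eqP/negPn/negP => /zS /dis; apply.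
  ring.
have jS2 : cvec c j \in S2 by have := cvec_sides j glT; rewrite (negPf jS1).
have bj : (0 < b 0%R j)%N by rewrite lt0n; apply/eqP; have [|] := hab j; rewrite ?(a0 j).
have yE' : y' = 0.
  have := WE' j; rewrite W_S2 // xE'; have := z0' j; nia.
case: W0; apply/rowP => i; rewrite mxE; have [/W_S2 //|iS2] := boolP (cvec c i \in S2).
rewrite WE' xE' yE'.
have ->: z' i = 0 by apply/eqP/negPn/negP => /zS'; apply/negP.
ring.
Qed.

(** As [a] is alone in [S1], w = x a, and m a lies in the intersection, so
    m = x l. The positive combination equal to p^k w contains no [b], as [b] is
    nonzero at an index where [a] vanishes, so c | p^k x a; this reads
    m g(T) | p^k x, and multiplying by l leaves g(T) | p^k. *)
Lemma gT_dvd_of_separated p n c (a b : 'rV[nat]_n) (S1 S2 : {fset 'rV[int]_n}) :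
    (0 < c)%N -> pgluing p (Tset c a b) S1 S2 ->
    gcdn c (gcdn (gcdv a) (gcdv b)) = 1%N ->
    ~~ (supp a \subset supp b) -> ~~ (supp b \subset supp a) ->
    vecZ a \in S1 -> vecZ b \in S2 -> (forall i, cvec c i \in S2) ->
  exists k, (gT c a b %| p ^ k)%N.
Proof.
move=> c0 glT cop /supp_witness[j [aj _]] /supp_witness[h [bh ah]] aS1 bS2 cS2.
have [sub1 sub2 _ dis] := splits_sub glT.1.
have [m [m0 mE mP]] := gT_order cop c0.
have [_ [k [w [_ wZ [_ W2]]]]] := glT; exists k.
have [w1 w2] : Zspan S1 w /\ Zspan S2 w by apply/wZ; exists 1; rewrite mulr1z.
have [x wE] : exists x, forall i, w 0 i = x * (a 0 i)%:Z.
  have [x [y [z [_ yS zS wE]]]] := (Zspan_coords _ sub1).1 w1.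
  exists x => i; rewrite wE.
  have ->: y = 0 by apply/eqP/negPn/negP => /yS /dis; apply.
  have ->: z i = 0 by apply/eqP/negPn/negP => /zS /dis; apply.
  ring.
have [l ml] : exists l, m%:Z = x * l.
  have [y yP] := (mP m).2 (dvdzz _).
  have /wZ[l lE] : Zspan S1 (vecZ a *~ m) /\ Zspan S2 (vecZ a *~ m).
    split; first exact: Zspan_mem.
    apply/(Zspan_coords _ sub2).
    exists 0, y, (fun i => ((m%:Z * (a 0%R i)%:Z - y * (b 0%R i)%:Z)%R %/ c)%Z).
    split; rewrite ?eqxx // => i; rewrite divzK // mulmxzE mxE; ring.
  exists l; have := congr1 (fun v : 'rV__ => v 0 j) lE.
  rewrite !mulmxzE wE mxE mulrC mulrAC => /mulIf; apply.
  by rewrite eqz_nat.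
have cW i : (c %| (x * (p ^ k)%N%:Z)%R * a 0%R i)%Z.
  have [x' [y [z [_ y0 z0 [xS _ _ WE]]]]] := Nspan_coords sub2 W2.
  have xE : x' = 0 by apply/eqP/negPn/negP => /xS; apply: dis.
  have WaE r : x * (p ^ k)%N%:Z * (a 0 r)%:Z = y * (b 0 r)%:Z + z r * c%:Z.
    have := WE r; rewrite xE mulmxnE -[_ *+ (p ^ k)%N]mulr_natr natz wE => E.
    by rewrite mulrAC E; ring.
  have yE : y = 0.
    have := WaE h; rewrite ah; have := z0 h; have := lt0n (b 0 h); nia.
  by rewrite WaE yE mul0r add0r dvdz_mull.
have /(dvdz_mul_gcdvE _ c0 mE) dW := cW.
suff: ((m * gT c a b)%N %| (m * p ^ k)%N%:Z)%Z by rewrite dvdzE /= dvdn_pmul2l.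
by rewrite [X in (_ %| X)%Z]PoszM ml mulrAC dvdz_mulr.
Qed.

(** The case distinction on the top splitting: exchanging the two parts puts [a]
    in [S1], and then [b] is on the same side or on the other. *)
Lemma gT_of_pgluing p n c (a b : 'rV[nat]_n) (S1 S2 : {fset 'rV[int]_n}) :
    prime p -> (0 < c)%N ->
    (forall i : 'I_n, a 0 i <> 0%N \/ b 0 i <> 0%N) ->
    gcdn c (gcdn (gcdv a) (gcdv b)) = 1%N ->
    ~~ (supp a \subset supp b) -> ~~ (supp b \subset supp a) ->
    pgluing p (Tset c a b) S1 S2 ->
  exists k, gT c a b = (p ^ k)%N.
Proof.
move=> p_pr c0 hab cop hsab hsba.
have hba i : b 0 i <> 0%N \/ a 0 i <> 0%N by have [] := hab i; [right | left].
have cop' : gcdn c (gcdn (gcdv b) (gcdv a)) = 1%N by rewrite [gcdn (gcdv b) _]gcdnC.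
wlog aS1 : S1 S2 / vecZ a \in S1 => [H glT|glT].
  have [_ _ cov _] := splits_sub glT.1.
  have /cov/orP[|] : vecZ a \in Tset c a b by rewrite in_Tset eqxx.
    by move=> aS1; apply: H aS1 glT.
  by move=> aS2; apply: H aS2 (pgluingC glT).
have glT' : pgluing p (Tset c b a) S1 S2 by rewrite TsetC.
have [sub1 sub2 cov dis] := splits_sub glT.1.
have /cov/orP[bS1|bS2] : vecZ b \in Tset c a b by rewrite in_Tset eqxx orbT.
  exists 0%N; rewrite expn0; apply: gT_eq1_of_disjoint => //.
  have [W [/eqP W0]] := glue_multiple p_pr glT.
  move=> /(Nspan_coords sub1)[x [y [z [x0 y0 z0 [_ _ zS WE]]]]].
  move=> /(Nspan_coords sub2)[x' [y' [z' [_ _ z0' [xS' yS' zS' WE']]]]].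
  have xE' : x' = 0 by apply/eqP/negPn/negP => /xS'; apply: dis.
  have yE' : y' = 0 by apply/eqP/negPn/negP => /yS'; apply: dis.
  have W_S1 i : cvec c i \notin S2 ->
      x * (a 0 i)%:Z + y * (b 0 i)%:Z + z i * c%:Z = 0.
    move=> iS2; rewrite -WE WE' xE' yE'.
    have ->: z' i = 0 by apply/eqP/negPn/negP => /zS'; apply/negP.
    ring.
  (* W vanishes wherever c e_i is not in S2, and its coefficients are
     nonnegative: a vector used with a positive coefficient vanishes there. *)
  have [xE|x_neq0] := eqVneq x 0; last first.
    apply: (disjoint_supp_of_same_side c0 glT) => // i /W_S1.
    have := z0 i; have : 0 < x by rewrite lt_def x_neq0.
    nia.
  have [yE|y_neq0] := eqVneq y 0; last first.
    suff H i : b 0 i = 0%N \/ a 0 i = 0%N by move=> i; have [] := H i; [right | left].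
    apply: (disjoint_supp_of_same_side c0 glT') => // {}i /W_S1.
    have := z0 i; have : 0 < y by rewrite lt_def y_neq0.
    nia.
  case: W0; apply/rowP => i; rewrite mxE.
  have [iS2|/W_S1 <-] := boolP (cvec c i \in S2); last exact: WE.
  rewrite WE xE yE; have ->: z i = 0 by apply/eqP/negPn/negP => /zS /dis; apply.
  ring.
suff: (forall i, cvec c i \in S2) \/ (forall i, cvec c i \in S1).
  case=> cS.
    have [k] := gT_dvd_of_separated c0 glT cop hsab hsba aS1 bS2 cS.
    by case/(dvdn_pfactor _ _ p_pr) => l _ ->; exists l.
  have [k] := gT_dvd_of_separated c0 (pgluingC glT') cop' hsba hsab bS2 aS1 cS.
  by rewrite gTC; case/(dvdn_pfactor _ _ p_pr) => l _ ->; exists l.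
(* If a and b each met the region of the other side, their two cuts would be
   nonzero with disjoint supports. *)
have [/existsP[i /andP[iS2 ai]]|/existsPn a0] :=
    boolP [exists i, (cvec c i \in S2) && (a 0 i != 0%N)]; last first.
  right; apply: (cvec_same_side_of_separated p_pr glT hab aS1 bS2) => i iS2.
  by apply/eqP; have := a0 i; rewrite iS2 negbK.
left; apply: (cvec_same_side_of_separated p_pr (pgluingC glT') hba bS2 aS1) => j jS1.
apply/eqP/negPn/negP => bj.
have cutb := cut_common (pgluingC glT') bS2.
have [iS1 _] := cuts_meet c0 glT (cut_common glT aS1) (conj cutb.2 cutb.1)
  iS2 jS1 ai bj.
exact: dis iS1 iS2.
Qed.

(** * Constructing gluings *)

(** For a nonnegative [w] this interpolates between the two kinds of gluing:
    [N = 1] is a gluing, and [N = p ^ k] gives a [p]-gluing. *)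
Definition scaled_gluing (N : nat) n (S S1 S2 : {fset 'rV[int]_n}) : Prop :=
  splits S S1 S2 /\
  exists w : 'rV[int]_n,
    [/\ w <> 0, forall i, 0 <= w 0 i,
        forall u, Zspan S1 u /\ Zspan S2 u <-> exists x : int, u = w *~ x
      & Nspan S1 (w *+ N) /\ Nspan S2 (w *+ N)].

Lemma scaled_gluing_fset1 n (v : 'rV[int]_n) (S : {fset 'rV[int]_n}) (m k : nat) :
    v != 0 -> (forall i, 0 <= v 0 i) -> v \notin S -> S != fset0 -> (0 < m)%N ->
    (forall x : int, Zspan S (v *~ x) <-> (m %| x)%Z) -> Nspan S (v *+ (m * k)) ->
  scaled_gluing k (v |` S) [fset v] S.
Proof.
move=> v0 v_ge0 vS S0 m0 mP vmk; split.
  split=> //; [|by apply/eqP; rewrite -cardfs_gt0 cardfs1 | by apply/eqP].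
  apply/eqP; rewrite -fsubset0; apply/fsubsetP => s.
  by rewrite !inE => /andP[/eqP ->]; rewrite (negPf vS).
have [i vi] : exists i, v 0 i != 0.
  apply/existsP; apply: contraNT v0 => /existsPn v0; apply/eqP/rowP => i.
  by rewrite mxE; apply/eqP/negPn.
exists (v *+ m); split.
- move/(congr1 (fun u : 'rV__ => u 0 i)); rewrite mulmxnE mxE => /eqP.
  by rewrite mulrn_eq0 (negPf vi) orbF -leqn0 leqNgt m0.
- by move=> j; rewrite mulmxnE mulrn_wge0.
- move=> u; split=> [[/Zspan_fset1[x ->] /mP/dvdzP[q ->]]|[x ->]].
    by exists q; rewrite pmulrn -mulrzA mulrC.
  rewrite pmulrn -mulrzA; split; last by apply/mP; rewrite dvdz_mulr.
  by apply/Zspan_fset1; exists (m%:Z * x).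
by rewrite -mulrnA; split=> //; apply: Nspan_mem; rewrite inE.
Qed.

Lemma vecZ_ge0 n (a : 'rV[nat]_n) i : 0 <= vecZ a 0 i.
Proof. by rewrite mxE. Qed.

Lemma vecZ_neq0 n (a b : 'rV[nat]_n) : ~~ (supp a \subset supp b) -> vecZ a != 0.
Proof.
move=> /supp_witness[j [aj _]]; apply: contraNneq aj => a0.
by have := congr1 (fun v : 'rV__ => v 0 j) a0; rewrite !mxE => -[->].
Qed.

(** Let m be the order of [b] modulo [c]. The multiples of [b] that lie in cZ^n
    are those of m b, and m b lies in cN^n because [b] is nonnegative. *)
Lemma complete_intersection_add_cset n c (b : 'rV[nat]_n) :
    (0 < c)%N -> (0 < n)%N -> vecZ b != 0 -> vecZ b \notin cset n c ->
  complete_intersection (vecZ b |` cset n c).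
Proof.
move=> c0 n0 b0 bC.
have bT : cset n c `<=` Tset c b b.
  by apply/fsubsetP => s; rewrite in_Tset inE => ->; rewrite !orbT.
have [m mE] : exists m, (m * gcdn c (gcdv b))%N = c.
  by exists (c %/ gcdn c (gcdv b))%N; rewrite divnK ?dvdn_gcdl.
have m0 : (0 < m)%N by move: c0; rewrite -mE; case: m {mE}.
have cC i : cvec c i \in cset n c by rewrite inE codom_f.
have mP (x : int) : Zspan (cset n c) (vecZ b *~ x) <-> (m %| x)%Z.
  rewrite -(dvdz_mul_gcdvE _ c0 mE) (Zspan_coords _ bT).
  split=> [[y [y' [z [yC yC' _ E]]]] i|cb].
    have nz (t : int) : (t != 0 -> vecZ b \in cset n c) -> t = 0.
      by rewrite (negPf bC) => H; apply/eqP/negPn/negP => /H.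
    have := E i; rewrite (nz _ yC) (nz _ yC') mulmxzE mxE mulrC => ->.
    by rewrite !mul0r !add0r dvdz_mull.
  exists 0, 0, (fun i => ((x * (b 0%R i)%:Z)%R %/ c)%Z).
  split; rewrite ?eqxx // => i; rewrite divzK // mulmxzE mxE; ring.
have := @scaled_gluing_fset1 _ (vecZ b) (cset n c) m 1 b0 (vecZ_ge0 b) bC _ m0 mP.
case=> [||sp [w [w0 w_ge0 wZ wN]]].
- by apply/fset0Pn; exists (cvec c (Ordinal n0)).
- apply: (Nspan_cvec (c := c)) => // i; rewrite muln1 mulmxnE mxE ?mulrn_wge0 //.
  rewrite -mulr_natr natz mulrC; exact: (dvdz_mul_gcdvE _ c0 mE).2 (dvdzz _) i.
exists [fset vecZ b] (cset n c).
- by split=> //; exists w.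
- by right; apply: generates_free1.
- by right; apply: generates_free_cset.
Qed.

(** The intersection is generated by m a, with m the order of [gT_order], and
    g(T) m a lies in cN^n since m g(T) is the order of [a] modulo cZ^n. *)
Lemma scaled_gluing_split_off n c (a b : 'rV[nat]_n) (k : nat) :
    (0 < c)%N -> (0 < n)%N -> uniq (Tseq c a b) ->
    gcdn c (gcdn (gcdv a) (gcdv b)) = 1%N ->
    vecZ a != 0 -> (gT c a b %| k)%N ->
  scaled_gluing k (Tset c a b) [fset vecZ a] (vecZ b |` cset n c).
Proof.
move=> c0 n0 /andP[aT _] cop a0 gk; set S := vecZ b |` cset n c.
have TE : Tset c a b = vecZ a |` S.
  by apply/fsetP => s; rewrite in_Tset !inE.
have aS : vecZ a \notin S by move: aT; rewrite !inE.
have ST : S `<=` Tset c a b by rewrite TE fsubsetU1.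
have cS i : cvec c i \in S by rewrite !inE codom_f orbT.
have bS : vecZ b \in S by rewrite !inE eqxx.
have [m [m0 mE mP]] := gT_order cop c0.
rewrite TE; apply: (scaled_gluing_fset1 (m := m)) => //.
- exact: vecZ_ge0.
- by apply/fset0Pn; exists (vecZ b).
- move=> x; rewrite -mP (Zspan_coords _ ST).
  split=> [[x' [y [z [xS _ _ E]]]]|[y yP]].
    exists y => i; have := E i.
    have ->: x' = 0 by apply/eqP/negPn/negP => /xS; apply/negP.
    rewrite mulmxzE mxE mulrC => ->.
    by rewrite mul0r add0r addrAC subrr add0r dvdz_mull.
  exists 0, y, (fun i => ((x * (a 0%R i)%:Z - y * (b 0%R i)%:Z)%R %/ c)%Z).
  split; rewrite ?eqxx // => i; rewrite divzK // mulmxzE mxE; ring.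
apply: (Nspan_cvec (c := c)) => // i; rewrite mulmxnE mxE ?mulrn_wge0 //.
rewrite -mulr_natr natz mulrC; apply: (dvdz_mul_gcdvE _ c0 mE).2 i.
by rewrite dvdzE /= dvdn_pmul2l.
Qed.

(** A gluing is a [p]-gluing with [k = 0]. The recursive calls sit inside a
    disjunction, so the induction is an explicit fixpoint on the derivation. *)
Lemma completely_pglued_of_ci p n (S : {fset 'rV[int]_n}) :
  complete_intersection S -> completely_pglued p S.
Proof.
move: S; fix IH 2 => S [S1 S2 [sp [w [w0 _ wZ wN]]] h1 h2].
exists S1 S2.
- by split=> //; exists 0%N, w; rewrite expn0 mulr1n.
- by case: h1 => [/IH|]; [left | right].
- by case: h2 => [/IH|]; [left | right].
Qed.

(** * The classification *)

Lemma prime_power_or_two_primes g : (0 < g)%N ->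
    (exists p k, prime p /\ g = (p ^ k)%N) \/
    (exists p q, [/\ prime p, prime q, p <> q, (p %| g)%N & (q %| g)%N]).
Proof.
move=> g0; have [->|g1] := eqVneq g 1%N; first by left; exists 2%N, 0%N.
have pP : prime (pdiv g) by rewrite pdiv_prime //; case: g g0 g1 => [|[]].
have [/p_natP[k gE]|] := boolP ((pdiv g).-nat g); first by left; exists (pdiv g), k.
rewrite /pnat g0 => /allPn[q]; rewrite mem_primes !inE => /and3P[qP _ qg] /eqP qp.
by right; exists q, (pdiv g); split=> //; apply: pdiv_dvd.
Qed.

Theorem proposition9 (n c : nat) (a b : 'rV[nat]_n)
    (hn : (1 <= n)%N) (hc : (1 <= c)%N)
    (hab : forall i : 'I_n, a 0 i <> 0%N \/ b 0 i <> 0%N)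
    (hT : uniq (Tseq c a b))
    (hgcd : gcdn c (gcdn (gcdv a) (gcdv b)) = 1%N)
    (hsab : ~~ (supp a \subset supp b))
    (hsba : ~~ (supp b \subset supp a)) :
  [/\ forall p : nat, prime p ->
        ((completely_pglued p (Tset c a b) /\
          forall q : nat, prime q -> completely_pglued q (Tset c a b) -> q = p)
         <-> exists k : nat, (0 < k)%N /\ gT c a b = (p ^ k)%N),
      (forall p : nat, prime p -> completely_pglued p (Tset c a b))
        <-> gT c a b = 1%N,
      (forall p : nat, prime p -> ~ completely_pglued p (Tset c a b))
        <-> (exists p q : nat, [/\ prime p, prime q, p <> q,
               (p %| gT c a b)%N & (q %| gT c a b)%N])
    & (forall p : nat, prime p -> completely_pglued p (Tset c a b))
        <-> complete_intersection (Tset c a b)].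
Proof.
have bC : vecZ b \notin cset n c.
  by move: hT => /and3P[_ bT _]; rewrite inE.
have freeA := generates_free1 (vecZ_neq0 hsab).
have ciB := complete_intersection_add_cset hc hn (vecZ_neq0 hsba) bC.
have glued p : prime p ->
    completely_pglued p (Tset c a b) <-> exists k, gT c a b = (p ^ k)%N.
  move=> p_pr; split=> [[S1 S2 glT _ _]|[k gE]]; first exact: gT_of_pgluing glT.
  have [|sp [w [w0 _ wZ wN]]] := scaled_gluing_split_off (k := p ^ k) hc hn hT hgcd
    (vecZ_neq0 hsab); first by rewrite gE.
  exists [fset vecZ a] (vecZ b |` cset n c); first by split=> //; exists k, w.
    by right.
  by left; apply: completely_pglued_of_ci.
have ci1 : gT c a b = 1%N -> complete_intersection (Tset c a b).
  move=> g1; have [|sp [w [w0 w_ge0 wZ wN]]] :=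
    scaled_gluing_split_off (k := 1) hc hn hT hgcd (vecZ_neq0 hsab); first by rewrite g1.
  exists [fset vecZ a] (vecZ b |` cset n c); first by split=> //; exists w.
    by right.
  by left.
have g0 : (0 < gT c a b)%N.
  have [m [_ mE _]] := gT_order hgcd hc.
  by move: hc; rewrite -{1}mE !muln_gt0 => /andP[/andP[]].
have all1 : (forall p, prime p -> completely_pglued p (Tset c a b)) <-> gT c a b = 1%N.
  (* A number that is both a power of 2 and a power of 3 is 1. *)
  split=> [all_p|g1 p p_pr]; last by apply/glued => //; exists 0%N.
  have /glued[//|k gk] := all_p 2%N isT; have /glued[//|l gl] := all_p 3%N isT.
  case: k gk => [//|k] gk; have : (2 %| 3 ^ l)%N by rewrite -gl gk expnS dvdn_mulr.
  by rewrite Euclid_dvdX.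
split=> //.
- move=> p p_pr; split=> [[/(glued _ p_pr)[k gk] only_p]|[k [k0 gk]]].
    (* If g(T) = 1, both 2 and 3 would be the only prime for which T is glued. *)
    case: k gk => [g1|k gk]; last by exists k.+1.
    have /all1 all_p : gT c a b = 1%N by [].
    by have := only_p 2%N isT (all_p 2%N isT); rewrite -(only_p 3%N isT (all_p 3%N isT)).
  split=> [|q q_pr /(glued _ q_pr)[l gl]]; first by apply/glued => //; exists k.
  have : (p %| q ^ l)%N by rewrite -gl gk -(prednK k0) expnS dvdn_mulr.
  by rewrite Euclid_dvdX // dvdn_prime2 // => /andP[/eqP ->].
- split=> [none|[p [q [p_pr q_pr pq pg qg]]] r r_pr /(glued _ r_pr)[k gk]].
    have [[p [k [p_pr gk]]]|//] := prime_power_or_two_primes g0.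
    by case: (none p p_pr); apply/glued => //; exists k.
  move: pg qg; rewrite gk !Euclid_dvdX // !dvdn_prime2 //.
  by move=> /andP[/eqP pr _] /andP[/eqP qr _]; case: pq; rewrite pr qr.
split=> [/all1/ci1 //|ciT p _]; exact: completely_pglued_of_ci.
Qed.
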